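(* Let $\mathbb{S}=\bigl\{\{1,2\},\{2,3\},\{1,3\}\bigr\}$ and $\mathcal{X}=[r] \times [s] \times [2]$ for some $r,s \in \mathbb{N}$. Then for any $P_{\mathbb{S}} \in \mathcal{P}_{\mathbb{S}}^{\mathrm{cons}}$, with associated masses $p_{\mathbb{S}}$, \[ R(P_{\mathbb{S}}) = 2 \max_{A \subseteq [r], B \subseteq[s]} (-p_{AB \bullet} +p_{A \bullet 1} + p_{\bullet B 1} - p_{\bullet \bullet 1})_+. \] Moreover, \[ \mathcal{P}_{\mathbb{S}}^{0,*} + \mathcal{P}_{\mathbb{S}}^{\mathrm{cons},**} = \Bigl\{ P_{\mathbb{S}} \equiv p_{\mathbb{S}} \in \mathcal{P}_{\mathbb{S}}^{\mathrm{cons},*}: \max_{A \subseteq [r], B \subseteq[s]} (-p_{AB \bullet} +p_{A \bullet 1} + p_{\bullet B 1} - p_{\bullet \bullet 1}) \leq 1/2 \Bigr\}. \]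
   Context: Notation: $[m] := \{1,\ldots,m\}$, $y_+ := \max(y,0)$; $\mathcal{X}_1 = [r]$, $\mathcal{X}_2=[s]$, $\mathcal{X}_3 = [2]$, $\mathcal{X}_S := \prod_{j \in S}\mathcal{X}_j$, $x_S := (x_j : j \in S)$. $\mathcal{P}_{\mathbb{S}}$ is the set of sequences $P_{\mathbb{S}} = (P_S : S \in \mathbb{S})$ with $P_S$ a probability distribution on $\mathcal{X}_S$. $\mathcal{P}_{\mathbb{S}}^0 \subseteq \mathcal{P}_{\mathbb{S}}$ is the subset of compatible sequences: those for which there is a distribution on $\mathcal{X}$ with marginal $P_S$ on $\mathcal{X}_S$ for every $S \in \mathbb{S}$. $\mathcal{P}_{\mathbb{S}}^{\mathrm{cons}} \subseteq \mathcal{P}_{\mathbb{S}}$ is the subset of consistent sequences: those for which, whenever $S_1,S_2 \in \mathbb{S}$ have $S_1 \cap S_2 \neq \emptyset$, the marginals of $P_{S_1}$ and $P_{S_2}$ on $\mathcal{X}_{S_1 \cap S_2}$ agree. Further, $\mathcal{P}_{\mathbb{S}}^{0,*} := \{\lambda P_{\mathbb{S}} : P_{\mathbb{S}} \in \mathcal{P}_{\mathbb{S}}^0, \lambda \geq 0\}$, $\mathcal{P}_{\mathbb{S}}^{\mathrm{cons},*} := \{\lambda P_{\mathbb{S}} : P_{\mathbb{S}} \in \mathcal{P}_{\mathbb{S}}^{\mathrm{cons}}, \lambda \geq 0\}$ and $\mathcal{P}_{\mathbb{S}}^{\mathrm{cons},**} := \{\lambda P_{\mathbb{S}} : P_{\mathbb{S}}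 \in \mathcal{P}_{\mathbb{S}}^{\mathrm{cons}}, \lambda \in [0,1]\}$ (componentwise scaling of measures), and $+$ denotes Minkowski sum. Sequences of measures are identified with their mass functions $p_{\mathbb{S}}$. For a consistent sequence of measures, $p_{AB\bullet} := P_{\{1,2\}}(A \times B)$, $p_{A\bullet 1} := P_{\{1,3\}}(A \times \{1\})$, $p_{\bullet B 1} := P_{\{2,3\}}(B \times \{1\})$ and $p_{\bullet\bullet 1} := P_{\{1,3\}}([r]\times\{1\}) = P_{\{2,3\}}([s]\times\{1\})$. Incompatibility index (discrete case): let $\mathcal{G}_{\mathbb{S}}^+$ be the set of sequences $f_{\mathbb{S}} = (f_S : S \in \mathbb{S})$ of functions $f_S : \mathcal{X}_S \to [-1,\infty)$ with $\min_{x \in \mathcal{X}} \sum_{S \in \mathbb{S}} f_S(x_S) \geq 0$. Then $R(P_{\mathbb{S}}) := \sup_{f_{\mathbb{S}} \in \mathcal{G}_{\mathbb{S}}^+} \bigl\{-\frac{1}{|\mathbb{S}|}\sum_{S \in \mathbb{S}} \sum_{x_S \in \mathcal{X}_S} f_S(x_S) P_S(\{x_S\})\bigr\}$. *)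

(* Defs.v *)
From HB Require Import structures.
From mathcomp Require Import all_boot all_order all_algebra.
From mathcomp Require Import boolp classical_sets reals.

Set Implicit Arguments.
Unset Strict Implicit.
Unset Printing Implicit Defensive.

Import Order.TTheory GRing.Theory Num.Theory.

Local Open Scope ring_scope.
Local Open Scope classical_set_scope.

(* The product of the alphabets X j over j in S, i.e. the space of the x_S;
   the full space is cart X [set: 'I_d]. *)
Definition cart (d : nat) (X : 'I_d -> finType) (S : {set 'I_d}) : finType :=
  {dffun forall j : {j : 'I_d | j \in S}, X (sval j)}.

Definition restr (d : nat) (X : 'I_d -> finType) (S T : {set 'I_d})
    (sTS : T \subset S) (x : cart X S) : cart X T :=
  [ffun j : {j : 'I_d | j \in T} =>
     x (exist _ (sval j) (fintype.subsetP sTS (sval j) (svalP j)))].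

Definition marginal (R : realType) (d : nat) (X : 'I_d -> finType)
    (S T : {set 'I_d}) (sTS : T \subset S) (p : cart X S -> R) :
    cart X T -> R :=
  fun y => \sum_(x : cart X S | restr sTS x == y) p x.

Definition is_pmf (R : realType) (T : finType) (p : T -> R) : Prop :=
  (forall x, 0 <= p x) /\ \sum_(x : T) p x = 1.

(* Families (g_S : S \in SS) of real functions on the spaces of the x_S; they
   serve both as mass functions and as test functions. *)
Definition family_on (R : realType) (d : nat) (X : 'I_d -> finType)
    (SS : {set {set 'I_d}}) : Type :=
  forall S : {S : {set 'I_d} | S \in SS}, cart X (sval S) -> R.

Definition addf (R : realType) (d : nat) (X : 'I_d -> finType)
    (SS : {set {set 'I_d}}) (p q : family_on R X SS) : family_on R X SS :=
  fun S x => p S x + q S x.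

Definition scalef (R : realType) (d : nat) (X : 'I_d -> finType)
    (SS : {set {set 'I_d}}) (a : R) (p : family_on R X SS) :
    family_on R X SS :=
  fun S x => a * p S x.

Definition Prob (R : realType) (d : nat) (X : 'I_d -> finType)
    (SS : {set {set 'I_d}}) : set (family_on R X SS) :=
  [set p | forall S, is_pmf (p S)].

Definition Compat (R : realType) (d : nat) (X : 'I_d -> finType)
    (SS : {set {set 'I_d}}) : set (family_on R X SS) :=
  [set p | Prob p /\
     exists q : cart X [set: 'I_d]%SET -> R, is_pmf q /\
       forall S, marginal (finset.subsetT (sval S)) q = p S].

Definition Consistent (R : realType) (d : nat) (X : 'I_d -> finType)
    (SS : {set {set 'I_d}}) : set (family_on R X SS) :=
  [set p | Prob p /\
     forall S1 S2 : {S : {set 'I_d} | S \in SS},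
       (sval S1 :&: sval S2 != finset.set0)%SET ->
       marginal (finset.subsetIl (sval S1) (sval S2)) (p S1) =
       marginal (finset.subsetIr (sval S1) (sval S2)) (p S2)].

Definition CompatCone (R : realType) (d : nat) (X : 'I_d -> finType)
    (SS : {set {set 'I_d}}) : set (family_on R X SS) :=
  [set scalef a p | a in [set a : R | 0 <= a] & p in @Compat R d X SS].

Definition ConsistentCone (R : realType) (d : nat) (X : 'I_d -> finType)
    (SS : {set {set 'I_d}}) : set (family_on R X SS) :=
  [set scalef a p | a in [set a : R | 0 <= a] & p in @Consistent R d X SS].

Definition ConsistentSub (R : realType) (d : nat) (X : 'I_d -> finType)
    (SS : {set {set 'I_d}}) : set (family_on R X SS) :=
  [set scalef a p | a in [set a : R | 0 <= a <= 1] & p in @Consistent R d X SS].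

Definition msum (R : realType) (d : nat) (X : 'I_d -> finType)
    (SS : {set {set 'I_d}}) (U V : set (family_on R X SS)) :
    set (family_on R X SS) :=
  [set addf p q | p in U & q in V].

Definition Gplus (R : realType) (d : nat) (X : 'I_d -> finType)
    (SS : {set {set 'I_d}}) : set (family_on R X SS) :=
  [set f | (forall S x, -1 <= f S x) /\
     forall x : cart X [set: 'I_d]%SET,
       0 <= \sum_(S : {S : {set 'I_d} | S \in SS})
              f S (restr (finset.subsetT (sval S)) x)].

Definition incompat_obj (R : realType) (d : nat) (X : 'I_d -> finType)
    (SS : {set {set 'I_d}}) (p f : family_on R X SS) : R :=
  - (#|SS|%:R^-1 * \sum_(S : {S : {set 'I_d} | S \in SS})
                     \sum_(x : cart X (sval S)) f S x * p S x).

(* For p in Prob X SS and SS nonempty, f = 0 is admissible and f >= -1 bounds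
   the objective by 1, so that this real supremum is a genuine one. *)
Definition incompat (R : realType) (d : nat) (X : 'I_d -> finType)
    (SS : {set {set 'I_d}}) (p : family_on R X SS) : R :=
  sup [set incompat_obj p f | f in @Gplus R d X SS].

Lemma incompat_has_sup (R : realType) (d : nat) (X : 'I_d -> finType)
    (SS : {set {set 'I_d}}) (p : family_on R X SS) :
  (0 < #|SS|)%N -> Prob p ->
  has_sup [set incompat_obj p f | f in @Gplus R d X SS].
Proof.
move=> SS_gt0 pP; split.
  exists (incompat_obj p (fun _ _ => 0)), (fun _ _ => 0) => //.
  by split=> [S x|x]; rewrite ?oppr_le0 ?ler01 // big1.
exists 1 => _ [f [f_ge _] <-]; rewrite /incompat_obj lerNl.
rewrite mulrC ler_pdivlMr ?ltr0n // mulN1r.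
have -> : - #|SS|%:R = \sum_(S : {S : {set 'I_d} | S \in SS}) (-1) :> R.
  by rewrite sumr_const card_sig mulNrn.
apply: ler_sum => S _; have [p_ge0 p1] := pP S.
have -> : -1 = \sum_x (-1) * p S x :> R by rewrite -mulr_sumr p1 mulr1.
by apply: ler_sum => x _; exact: (ler_wpM2r (p_ge0 x) (f_ge S x)).
Qed.

(* Coordinates 1, 2, 3 and symbols 1, 2, ... are numbered from 0: the sets
   [r], [s], [2] are 'I_r, 'I_s, 'I_2, and the symbol 1 of [2] is ord0. *)
Definition c1 : 'I_3 := @Ordinal 3 0 isT.
Definition c2 : 'I_3 := @Ordinal 3 1 isT.
Definition c3 : 'I_3 := @Ordinal 3 2 isT.

Definition alph (r s : nat) (j : 'I_3) : finType :=
  'I_(nth 0%N [:: r; s; 2%N] j).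

Definition pairs3 : {set {set 'I_3}} :=
  [set [set c1; c2]; [set c2; c3]; [set c1; c3]]%SET.

Lemma S12_in : [set c1; c2]%SET \in pairs3.
Proof. by rewrite !inE eqxx. Qed.

Lemma S23_in : [set c2; c3]%SET \in pairs3.
Proof. by rewrite !inE eqxx orbT. Qed.

Lemma S13_in : [set c1; c3]%SET \in pairs3.
Proof. by rewrite !inE eqxx orbT. Qed.

Definition S12 : {S : {set 'I_3} | S \in pairs3} :=
  exist (fun S : {set 'I_3} => is_true (S \in pairs3)) _ S12_in.
Definition S23 : {S : {set 'I_3} | S \in pairs3} :=
  exist (fun S : {set 'I_3} => is_true (S \in pairs3)) _ S23_in.
Definition S13 : {S : {set 'I_3} | S \in pairs3} :=
  exist (fun S : {set 'I_3} => is_true (S \in pairs3)) _ S13_in.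

Definition fst_coord (X : 'I_3 -> finType) (i j : 'I_3)
    (x : cart X [set i; j]%SET) : X i := x (exist _ i (set21 i j)).
Definition snd_coord (X : 'I_3 -> finType) (i j : 'I_3)
    (x : cart X [set i; j]%SET) : X j := x (exist _ j (set22 i j)).

(* P_{i,j}(E * F). *)
Definition rect_mass (R : realType) (X : 'I_3 -> finType) (i j : 'I_3)
    (p : cart X [set i; j]%SET -> R) (E : {set X i}) (F : {set X j}) : R :=
  \sum_(x : cart X [set i; j]%SET | (fst_coord x \in E) && (snd_coord x \in F))
    p x.

Definition pAB_ (R : realType) (r s : nat)
    (p : family_on R (alph r s) pairs3) (A : {set 'I_r}) (B : {set 'I_s}) : R :=
  @rect_mass R (alph r s) c1 c2 (p S12) A B.

Definition pA_1 (R : realType) (r s : nat)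
    (p : family_on R (alph r s) pairs3) (A : {set 'I_r}) : R :=
  @rect_mass R (alph r s) c1 c3 (p S13) A [set (ord0 : 'I_2)]%SET.

Definition p_B1 (R : realType) (r s : nat)
    (p : family_on R (alph r s) pairs3) (B : {set 'I_s}) : R :=
  @rect_mass R (alph r s) c2 c3 (p S23) B [set (ord0 : 'I_2)]%SET.

(* Computed from P_{1,3}; for consistent p it is also P_{2,3}([s] * {1}). *)
Definition p__1 (R : realType) (r s : nat)
    (p : family_on R (alph r s) pairs3) : R := pA_1 p [set: 'I_r]%SET.

Definition excess (R : realType) (r s : nat)
    (p : family_on R (alph r s) pairs3) (A : {set 'I_r}) (B : {set 'I_s}) : R :=
  - pAB_ p A B + pA_1 p A + p_B1 p B - p__1 p.

(* The starting value is one of the F A B, so this is the maximum of F. *)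
Definition max_subsets (R : realType) (r s : nat)
    (F : {set 'I_r} -> {set 'I_s} -> R) : R :=
  \big[Num.max/F finset.set0 finset.set0]_(AB : {set 'I_r} * {set 'I_s})
    F AB.1 AB.2.

Definition pos_part (R : realType) (y : R) : R := Num.max y 0.

(* Main.v *)
Require Import Defs.
From HB Require Import structures.
From mathcomp Require Import all_boot all_order all_algebra.
From mathcomp Require Import boolp classical_sets reals.
From mathcomp Require Import ring lra.

(** Lower bound for the index.  Encode membership in A, membership in B and
    the third symbol by signs a, b, c.  The excess
    - p_AB + p_A1 + p_B1 - p__1 is minus the integral of (1 + ab - ac - bc) / 4,
    a function that is nonnegative because the three products ab, -ac, -bc
    multiply to 1, so that either none or two of them are -1.  Splitting 6 times
    this function evenly over the three pairs gives the test functions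
    1/2 + 3/2 * (product of two signs), which only take the values -1 and 2,
    hence are admissible ([cut_test_gplus]), and for which the objective is
    twice the excess ([pairing_cut_test]).

    Upper bound for the index.  Truncating an admissible f at 2 keeps it
    admissible and lowers its integral.  Since p_{12} has the same one-way
    marginals as p_{13} and p_{23}, the part of f_{13}(i,.) and f_{23}(j,.) that
    is symmetric in the third symbol can be moved to f_{12} at no cost
    ([table_pairingE]); only the antisymmetric parts x_i and y_j remain, with
    values in [0,3] after a shift that costs nothing.  The covering constraint then says
    that f_{12} is at least |x_i - y_j|, and the integral is at least a cut
    energy: the sum of p_{12}(i,j) |x_i - y_j| plus linear terms in x and y.
    Slicing (x, y) into its superlevel sets ([layer_cake]) bounds this energy
    below by 3 times its least value at a pair of indicators, and there it is
    -2 times an excess ([cut_energy_indicator]).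

    The Minkowski sum.  The functionals above are linear, so a sum of a
    compatible part and a consistent part of mass at most 1 has excess at most
    0 + 1/2 ([excess_msum]).  Conversely, linear programming duality
    ([packing_of_pairing_ge], from Farkas' lemma [farkas]) turns the lower
    bound on the integrals of admissible functions into a measure on the full
    space whose marginals are dominated by p and which misses at most mass 1 of
    p.  What remains of p is nonnegative, and its marginals agree because those
    of p do and those of the measure do; so it is a consistent family of mass
    at most 1 ([split_compat]). *)

Set Implicit Arguments.
Unset Strict Implicit.
Unset Printing Implicit Defensive.

Import Order.TTheory GRing.Theory Num.Theory.

Local Open Scope ring_scope.
Local Open Scope classical_set_scope.

(** * Systems of linear inequalities *)

Lemma between_exists (R : realFieldType) (I : finType) (P N : pred I)
    (u : I -> R) :
  (forall i l, P i -> N l -> u l <= u i) ->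
  exists t, (forall i, P i -> t <= u i) /\ (forall l, N l -> u l <= t).
Proof.
move=> NP; have [k0 Nk0|N0] := pickP N.
  case: (arg_maxP u Nk0) => k Nk maxk.
  by exists (u k); split=> [i Pi|l Nl]; [apply: NP|apply: maxk].
have [k0 Pk0|P0] := pickP P; last by exists 0; split=> i; rewrite ?N0 ?P0.
case: (arg_minP u Pk0) => k Pk mink.
by exists (u k); split=> [i Pi|l]; [apply: mink|rewrite N0].
Qed.

(** The multipliers by which Fourier-Motzkin elimination forms new rows, when
    the eliminated variable has coefficient [c i] in row [i]: a row with zero
    coefficient is kept, and a positive row is combined with a negative one so
    that the coefficients cancel.  Useless indices get the zero row, which
    avoids subtypes. *)
Definition fm_weight (R : realFieldType) (I : finType) (c : I -> R)
    (e : I + I * I) (k : I) : R :=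
  match e with
  | inl i => (c i == 0)%:R * (k == i)%:R
  | inr (i, l) => ((0 < c i) && (c l < 0))%:R *
                  (- c l * (k == i)%:R + c i * (k == l)%:R)
  end.

Lemma sum_delta (R : nzRingType) (I : finType) (i : I) (F : I -> R) :
  \sum_k (k == i)%:R * F k = F i.
Proof.
rewrite (bigD1 i) //= eqxx mul1r big1 ?addr0 // => k /negPf ->.
by rewrite mul0r.
Qed.

Lemma fm_weight_ge0 (R : realFieldType) (I : finType) (c : I -> R) e k :
  0 <= fm_weight c e k.
Proof.
case: e => [i|[i l]] /=; first by rewrite mulr_ge0 ?ler0n.
case: andP => [[ci cl]|_]; last by rewrite mul0r.
by rewrite mul1r addr_ge0 // mulr_ge0 ?ler0n ?oppr_ge0 // ltW.
Qed.

Lemma sum_fm_inl (R : realFieldType) (I : finType) (c F : I -> R) i :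
  \sum_k fm_weight c (inl i) k * F k = (c i == 0)%:R * F i.
Proof.
by rewrite -[in RHS](sum_delta i F) mulr_sumr; apply: eq_bigr => k _ /=; ring.
Qed.

Lemma sum_fm_inr (R : realFieldType) (I : finType) (c F : I -> R) i l :
  \sum_k fm_weight c (inr (i, l)) k * F k =
  ((0 < c i) && (c l < 0))%:R * (- c l * F i + c i * F l).
Proof.
rewrite -[in RHS](sum_delta i F) -[in RHS](sum_delta l F) !mulr_sumr.
rewrite -big_split /= mulr_sumr; apply: eq_bigr => k _ /=; ring.
Qed.

(** Eliminate the variables of [s] one at a time.  Each new row is a
    nonnegative combination of old rows, so a certificate of infeasibility of
    the smaller system pulls back along [fm_weight]; and a solution of the
    smaller system leaves for the eliminated variable an interval that is
    nonempty, as each of its lower bounds is below each of its upper bounds. *)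
Lemma fourier_motzkin (R : realFieldType) (J : eqType) (s : seq J) (I : finType)
    (A : I -> J -> R) (b : I -> R) : uniq s ->
  (exists x : J -> R, forall i, \sum_(j <- s) A i j * x j <= b i) \/
  (exists y : I -> R, [/\ forall i, 0 <= y i,
     forall j, j \in s -> \sum_i y i * A i j = 0 & \sum_i y i * b i < 0]).
Proof.
elim: s I A b => [|j0 s IHs] I A b.
  move=> _; have [/forallP b_ge0|] := boolP [forall i, 0 <= b i].
    by left; exists (fun=> 0) => i; rewrite big_nil.
  rewrite negb_forall => /existsP[i0]; rewrite -ltNge => bi0; right.
  exists (fun i => (i == i0)%:R); split=> //.
  by rewrite sum_delta.
case/andP=> j0s s_uniq; pose c i := A i j0; pose W := fm_weight c.
have [[x xP]|[y [y_ge0 yA yb]]] := IHs (I + I * I)%type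
    (fun e j => \sum_k W e k * A k j) (fun e => \sum_k W e k * b k) s_uniq.
- left; pose F k := b k - \sum_(j <- s) A k j * x j.
  (* [F k] is the room that the solution of the smaller system leaves in row
     [k] for the term of the eliminated variable. *)
  have WF e : 0 <= \sum_k W e k * F k.
    under eq_bigr do rewrite mulrBr mulr_sumr.
    rewrite sumrB subr_ge0 exchange_big /=; apply: le_trans (xP e).
    rewrite le_eqVlt; apply/orP; left; apply/eqP; apply: eq_bigr => j _.
    by rewrite mulr_suml; apply: eq_bigr => k _; rewrite mulrA.
  have [|t [tP tN]] := @between_exists R I (fun i => 0 < c i)
      (fun i => c i < 0) (fun i => F i / c i).
    move=> i l ci cl; have := WF (inr (i, l)).
    rewrite sum_fm_inr ci cl mul1r => le0.
    rewrite ler_pdivlMr // mulrAC ler_ndivrMr //; lra.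
  exists (fun j => if j == j0 then t else x j) => i.
  rewrite big_cons eqxx.
  have -> : \sum_(j <- s) A i j * (if j == j0 then t else x j) = b i - F i.
    rewrite /F opprB addrC subrK; apply: eq_big_seq => j js.
    by case: eqP => // ej; rewrite -ej js in j0s.
  suff: c i * t <= F i by rewrite /c; lra.
  have [ci|ci|ci] := ltgtP (c i) 0.
  + by have := tN i ci; rewrite ler_ndivrMr // mulrC.
  + by have := tP i ci; rewrite ler_pdivlMr // mulrC.
  + by have := WF (inl i); rewrite sum_fm_inl ci eqxx mul1r mul0r.
- right; exists (fun k => \sum_e y e * W e k).
  have swap (G : I -> R) : \sum_k (\sum_e y e * W e k) * G k =
      \sum_e y e * \sum_k W e k * G k.
    under eq_bigr do rewrite mulr_suml.
    rewrite exchange_big; apply: eq_bigr => e _; rewrite mulr_sumr.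
    by apply: eq_bigr => k _; rewrite mulrA.
  split=> [k|j|]; rewrite ?swap //.
    by apply: sumr_ge0 => e _; rewrite mulr_ge0 ?fm_weight_ge0.
  rewrite inE => /orP[/eqP ->|/yA //]; rewrite big1 // => -[i|[i l]] _.
    rewrite sum_fm_inl -/(c i); have [->|] := eqVneq (c i) 0.
      by rewrite !mulr0.
    by rewrite mul0r mulr0.
  by rewrite sum_fm_inr -/(c i) -/(c l); ring.
Qed.

(** The sign constraints are treated as further rows; their multipliers become
    the slack in the dual inequality. *)
Lemma farkas (R : realFieldType) (I J : finType) (A : I -> J -> R)
    (b : I -> R) :
  (exists x : J -> R, (forall j, 0 <= x j) /\
     forall i, \sum_j A i j * x j <= b i) \/
  (exists y : I -> R, [/\ forall i, 0 <= y i,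
     forall j, 0 <= \sum_i y i * A i j & \sum_i y i * b i < 0]).
Proof.
pose A' (e : J + I) (k : J) := match e with
  inl j => - (k == j)%:R | inr i => A i k end.
pose b' (e : J + I) := if e is inr i then b i else 0.
have [[x xP]|[y [y_ge0 yA yb]]] :=
    fourier_motzkin A' b' (index_enum_uniq J).
- left; exists x; split=> [j|i]; last exact: xP (inr i).
  have := xP (inl j); under eq_bigr do rewrite /= mulNr.
  by rewrite sumrN sum_delta oppr_le0.
- right; exists (fun i => y (inr i)); split=> // [j|]; last first.
    by move: yb; rewrite big_sumType /= big1 ?add0r // => j _; rewrite mulr0.
  have := yA j (mem_index_enum j); rewrite big_sumType /=.
  under eq_bigr do rewrite mulrN mulrC eq_sym.
  by rewrite sumrN sum_delta addrC => /subr0_eq ->.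
Qed.

(** * Packing a measure under a family of marginals *)

Section Families.
Variables (R : realType) (d : nat) (X : 'I_d -> finType) (SS : {set {set 'I_d}}).
Implicit Types (p f : family_on R X SS).

Definition pairing p f : R := \sum_S \sum_(x : cart X (sval S)) f S x * p S x.

Definition proj (S : {S : {set 'I_d} | S \in SS}) (z : cart X [set: 'I_d]%SET) :
  cart X (sval S) := restr (finset.subsetT (sval S)) z.

Definition marginals (mu : cart X [set: 'I_d]%SET -> R) : family_on R X SS :=
  fun S => marginal (finset.subsetT (sval S)) mu.

Arguments marginals mu S x : clear implicits.

Lemma sum_marginal (S T : {set 'I_d}) (sTS : T \subset S) (q : cart X S -> R) :
  \sum_y marginal sTS q y = \sum_x q x.
Proof. by rewrite [RHS](partition_big (restr sTS) xpredT). Qed.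

Lemma pairing_marginals mu f :
  pairing (marginals mu) f = \sum_z mu z * \sum_S f S (proj S z).
Proof.
under [RHS]eq_bigr do rewrite mulr_sumr.
rewrite [RHS]exchange_big; apply: eq_bigr => S _.
rewrite [RHS](partition_big (proj S) xpredT) //=; apply: eq_bigr => y _.
rewrite mulr_sumr; apply: eq_bigr => z /eqP <-; exact: mulrC.
Qed.

(** Linear programming duality for the largest mass of a measure whose
    marginals are dominated by [p].  A dual solution is a family [h] of
    nonnegative functions with a multiplier [t] for the mass constraint, such
    that the [h S] sum to at least [t] at every point; as an infeasibility
    certificate it violates the mass bound.  If [t] is positive, rescaling [h]
    to [#|SS| * h / t - 1] gives an element of [Gplus] that contradicts the
    hypothesis. *)
Lemma packing_of_pairing_ge p m k : (0 < #|SS|)%N ->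
    (forall S x, 0 <= p S x) -> (forall S, \sum_x p S x = m) ->
    (forall f, Gplus f -> - (#|SS|%:R * k) <= pairing p f) ->
  exists mu : cart X [set: 'I_d]%SET -> R, [/\ forall z, 0 <= mu z,
    forall S x, marginals mu S x <= p S x & m - k <= \sum_z mu z].
Proof.
move=> SS_gt0 p_ge0 p_mass pk; have n_gt0 : 0 < #|SS|%:R :> R by rewrite ltr0n.
pose A (e : {S : {S | S \in SS} & cart X (sval S)} + unit) z : R :=
  if e is inl Sx then (proj (tag Sx) z == tagged Sx)%:R else -1.
pose b (e : {S : {S | S \in SS} & cart X (sval S)} + unit) : R :=
  if e is inl Sx then p (tag Sx) (tagged Sx) else k - m.
have [[mu [mu_ge0 muP]]|[y [y_ge0 yA yb]]] := farkas A b.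
  exists mu; split=> // [S x|].
    have := muP (inl (Tagged (fun S => cart X (sval S)) x)).
    rewrite /= (_ : \sum_z _ = marginals mu S x) // /marginals /marginal.
    rewrite [RHS]big_mkcond /=; apply: eq_bigr => z _.
    by rewrite -/(proj S z); case: eqP => _; rewrite ?mul1r ?mul0r.
  have := muP (inr tt); under eq_bigr do rewrite mulN1r.
  by rewrite sumrN /b; lra.
pose h : family_on R X SS := fun S x =>
  y (inl (Tagged (fun S : {S | S \in SS} => cart X (sval S)) x)).
pose t := y (inr tt).
have sumU (F : unit -> R) : \sum_e F e = F tt.
  by rewrite (bigD1 tt) //= big1 ?addr0 // => -[].
have sumT (G : {S : {S | S \in SS} & cart X (sval S)} -> R) :
    \sum_e G e = \sum_S \sum_(x : cart X (sval S)) 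
      G (Tagged (fun S : {S | S \in SS} => cart X (sval S)) x).
  by rewrite sig_big_dep; apply: eq_bigr => -[S x].
have h_cover z : t <= \sum_S h S (proj S z).
  have := yA z; rewrite big_sumType /= sumU /= mulrN1 subr_ge0.
  rewrite sumT /=.
  congr (_ <= _); apply: eq_bigr => S _.
  by under eq_bigr do rewrite mulrC eq_sym; rewrite sum_delta.
have h_lt : pairing p h < t * (m - k).
  have := yb; rewrite big_sumType /= sumU /=.
  rewrite sumT /=.
  by rewrite /pairing -/t; lra.
have h_ge0 S x : 0 <= h S x by exact: y_ge0.
(* If [t] were 0, the certificate would say that a nonnegative sum is
   negative. *)
have t_gt0 : 0 < t.
  rewrite lt_neqAle y_ge0 andbT; apply/eqP => t0; move: h_lt.
  rewrite -t0 mul0r ltNge => /negP; apply; apply: sumr_ge0 => S _.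
  by apply: sumr_ge0 => x _; rewrite mulr_ge0.
pose g : family_on R X SS := fun S x => #|SS|%:R * (h S x / t) - 1.
have gP : Gplus g.
  split=> [S x|z].
    by rewrite /g lerDr mulr_ge0 ?ler0n // divr_ge0 // ltW.
  rewrite /g big_split /= sumr_const card_sig -mulr_sumr -mulr_suml mulNrn subr_ge0.
  by rewrite ler_peMr ?ler0n // ler_pdivlMr // mul1r h_cover.
have gE : pairing p g = #|SS|%:R * (pairing p h / t - m).
  have -> : #|SS|%:R * (pairing p h / t - m) =
      #|SS|%:R * (pairing p h / t) - \sum_(S : {S | S \in SS}) m.
    by rewrite sumr_const card_sig -[m *+ _]mulr_natl mulrBr.
  rewrite /pairing mulr_suml mulr_sumr -sumrB; apply: eq_bigr => S _.
  rewrite -(p_mass S) mulr_suml mulr_sumr -sumrB; apply: eq_bigr => x _.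
  by rewrite /g; ring.
have := pk g gP; rewrite gE -mulrN ler_pM2l // lerBrDr addrC.
by rewrite ler_pdivlMr // mulrC leNgt h_lt.
Qed.
End Families.

(** * Layer-cake bound *)

(** A nonnegative function is a combination of the indicators of its superlevel
    sets, and a functional that is additive along such nested slices is
    therefore controlled by its values on indicators.  The induction peels off
    the support at the height of the least positive value, which strictly
    shrinks the support and lowers the bound [M] by the same height. *)
Lemma layer_cake (R : realFieldType) (T : finType) (F : (T -> R) -> R) (K : R) :
    (forall (L : {set T}) m x, 0 <= m -> (forall u, 0 <= x u) ->
       (forall u, u \notin L -> x u = 0) ->
       F (fun u => m * (u \in L)%:R + x u) = m * F (fun u => (u \in L)%:R) + F x) ->
    (forall L : {set T}, K <= F (fun u => (u \in L)%:R)) ->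
  forall M x, 0 <= M -> (forall u, 0 <= x u <= M) -> M * K <= F x.
Proof.
move=> FD FK.
have F0 : F (fun=> 0) = 0.
  have e0 : (fun u : T => (u \in finset.set0)%:R) = (fun=> 0) :> (T -> R).
    by apply/funext => u; rewrite inE.
  have e1 : (fun u : T => 1 * (u \in finset.set0)%:R + 0) = (fun=> 0) :> (T -> R).
    by apply/funext => u; rewrite inE mulr0 addr0.
  have := FD finset.set0 1 (fun=> 0) ler01 (fun=> lexx _) (fun _ _ => erefl).
  rewrite e0 e1.
  by lra.
have K_le0 : K <= 0.
  rewrite -F0; apply: le_trans (FK finset.set0) _.
  rewrite le_eqVlt; apply/orP; left; apply/eqP; congr F.
  by apply/funext => u; rewrite inE.
move=> M x; have [n] := ubnP #|[set u | x u != 0]%SET|.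
elim: n M x => // n IHn M x; rewrite ltnS => xn M_ge0 xM.
set L := [set u | x u != 0]%SET in xn.
have [L0|[u1 u1L]] := set_0Vmem L.
  rewrite (_ : x = fun=> 0) ?F0; first by rewrite mulr_ge0_le0.
  apply/funext => u; apply/eqP; move/setP/(_ u): L0.
  by rewrite !inE => /negbFE.
case: (arg_minP x u1L) => u0; rewrite -/(u0 \in L) => u0L u0min; pose m := x u0.
have m_ge0 : 0 <= m by case/andP: (xM u0).
pose x' u := x u - m * (u \in L)%:R.
have x'0 u : u \notin L -> x' u = 0.
  by move=> uL; rewrite /x' (negPf uL) mulr0 subr0; move: uL; rewrite inE negbK => /eqP.
have x'M u : 0 <= x' u <= M - m.
  have [uL|/x'0->] := boolP (u \in L); last by rewrite lexx subr_ge0; case/andP: (xM u0).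
  by rewrite /x' uL mulr1 subr_ge0 u0min //= lerD2r; case/andP: (xM u).
rewrite (_ : x = fun u => m * (u \in L)%:R + x' u); last first.
  by apply/funext => u; rewrite /x' addrC subrK.
rewrite FD //; last by move=> u; case/andP: (x'M u).
have <- : m * K + (M - m) * K = M * K by ring.
apply: lerD; first by rewrite ler_wpM2l.
apply: IHn => //; last by rewrite subr_ge0; case/andP: (xM u0).
apply: leq_trans (proper_card _) xn; apply/properP; split.
  by apply/fintype.subsetP => u; rewrite inE; apply: contraNT => /x'0 ->.
by exists u0 => //; rewrite inE negbK /x' u0L mulr1 subrr.
Qed.

(** * The excess as a minimum cut *)

Section Tables.
(** [w] is the table of the pair (1,2); [a0], [a1] are the two columns of the
    table of the pair (1,3), for the two symbols of the third alphabet, and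
    [b0], [b1] those of the pair (2,3). *)
Variables (R : realFieldType) (I J : finType).
Variables (w : I -> J -> R) (a0 a1 : I -> R) (b0 b1 : J -> R).

Definition table_excess (A : {set I}) (B : {set J}) : R :=
  - (\sum_(i in A) \sum_(j in B) w i j) + \sum_(i in A) a0 i +
  \sum_(j in B) b0 j - \sum_i a0 i.

Definition table_pairing (f : I -> J -> R) (g0 g1 : I -> R) (h0 h1 : J -> R) : R :=
  \sum_i \sum_j f i j * w i j + \sum_i (g0 i * a0 i + g1 i * a1 i) +
  \sum_j (h0 j * b0 j + h1 j * b1 j).

Definition cut_energy (x : I -> R) (y : J -> R) : R :=
  \sum_i \sum_j w i j * `|x i - y j| + \sum_i x i * (a0 i - a1 i) -
  \sum_j y j * (b0 j - b1 j).

(** [cut_energy] is additive along superlevel sets of (x, y), seen as a single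
    function on [I + J]: a difference x_i - y_j is cut by the slices that contain
    exactly one of i and j, always with the same sign. *)
Lemma cut_energy_ge K M x y :
  (forall (A : {set I}) (B : {set J}),
     K <= cut_energy (fun i => (i \in A)%:R) (fun j => (j \in B)%:R)) ->
  0 <= M -> (forall i, 0 <= x i <= M) -> (forall j, 0 <= y j <= M) ->
  M * K <= cut_energy x y.
Proof.
move=> cutK M_ge0 xM yM.
pose F (z : I + J -> R) := cut_energy (z \o inl) (z \o inr).
pose z (u : I + J) := match u with inl i => x i | inr j => y j end.
apply: (@layer_cake R (I + J)%type F K _ _ M z) => // [L m z' m_ge0 z'_ge0 z'0|L|[]//].
  rewrite /F /cut_energy /= !mulrDr mulrN !mulr_sumr.
  rewrite [X in _ = X](_ : _ =
    (\sum_i m * \sum_j w i j * `|(inl i \in L)%:R - (inr j \in L)%:R| +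
     \sum_i \sum_j w i j * `|z' (inl i) - z' (inr j)|) +
    (\sum_i m * ((inl i \in L)%:R * (a0 i - a1 i)) +
     \sum_i z' (inl i) * (a0 i - a1 i)) -
    (\sum_j m * ((inr j \in L)%:R * (b0 j - b1 j)) +
     \sum_j z' (inr j) * (b0 j - b1 j))); last by ring.
  congr (_ + _ - _); rewrite -big_split /=; apply: eq_bigr => i _; try ring.
  rewrite mulr_sumr -big_split /=; apply: eq_bigr => j _.
  rewrite mulrCA -mulrDr; congr (_ * _).
  have := z'0 (inl i); have := z'0 (inr j).
  have := z'_ge0 (inl i); have := z'_ge0 (inr j).
  case: (_ \in L); case: (_ \in L) => /= zj zi zj0 zi0.
  - by rewrite subrr normr0 mulr0 add0r; congr `|_|; ring.
  - rewrite zi0 // !(mulr1, mulr0, addr0, add0r) !normrN normr1 mulr1.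
    by rewrite !ger0_norm // addr_ge0.
  - by rewrite zj0 // !(mulr1, mulr0, subr0, addr0) normr1 mulr1 !ger0_norm // addr_ge0.
  - by rewrite zi0 // zj0 // !(mulr0, addr0, subr0, normr0).
have := cutK (inl @^-1: L)%SET (inr @^-1: L)%SET.
by congr (_ <= cut_energy _ _); apply/funext => u; rewrite inE.
Qed.

Hypothesis row_sum : forall i, \sum_j w i j = a0 i + a1 i.
Hypothesis col_sum : forall j, \sum_i w i j = b0 j + b1 j.
Hypothesis mass0 : \sum_i a0 i = \sum_j b0 j.

Lemma row_weighted g : \sum_i \sum_j g i * w i j = \sum_i g i * a0 i + \sum_i g i * a1 i.
Proof.
by rewrite -big_split; apply: eq_bigr => i _; rewrite -mulr_sumr row_sum mulrDr.
Qed.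

Lemma col_weighted h : \sum_i \sum_j h j * w i j = \sum_j h j * b0 j + \sum_j h j * b1 j.
Proof.
rewrite exchange_big -big_split; apply: eq_bigr => j _.
by rewrite -mulr_sumr col_sum mulrDr.
Qed.

Lemma mass1 : \sum_i a1 i = \sum_j b1 j.
Proof.
have := row_weighted (fun=> 1); rewrite (col_weighted (fun=> 1)).
by rewrite -!mulr_sumr !mul1r mass0 => /addrI.
Qed.

(** At these indicators |x_i - y_j| tests whether i lies in A exactly when j
    lies in B; expanding it as 1 - a - b + 2ab leaves only the terms in ab, a and
    b of the excess, because the rows and columns of [w] sum to those of the
    other two tables. *)
Lemma cut_energy_indicator (A : {set I}) (B : {set J}) :
  cut_energy (fun i => (i \in ~: A)%:R) (fun j => (j \in B)%:R) =
  - 2 * table_excess A B.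
Proof.
pose a i : R := (i \in A)%:R; pose b j : R := (j \in B)%:R.
have sumA (G : I -> R) : \sum_(i in A) G i = \sum_i a i * G i.
  rewrite big_mkcond; apply: eq_bigr => i _.
  by rewrite /a; case: ifP; rewrite ?mul1r ?mul0r.
have sumB (G : J -> R) : \sum_(j in B) G j = \sum_j b j * G j.
  rewrite big_mkcond; apply: eq_bigr => j _.
  by rewrite /b; case: ifP; rewrite ?mul1r ?mul0r.
rewrite /table_excess !sumA sumB /cut_energy.
under eq_bigr do under eq_bigr do rewrite finset.in_setC.
have -> : \sum_i \sum_j w i j * `|(i \notin A)%:R - (j \in B)%:R| =
    \sum_i \sum_j w i j - \sum_i \sum_j a i * w i j - \sum_i \sum_j b j * w i j
    + 2 * \sum_i a i * \sum_(j in B) w i j.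
  rewrite mulr_sumr -!sumrB -big_split /=; apply: eq_bigr => i _.
  rewrite sumB mulrA mulr_sumr -!sumrB -big_split /=; apply: eq_bigr => j _.
  rewrite /a /b; case: (_ \in A); case: (_ \in B) => /=.
  - by rewrite sub0r normrN normr1; ring.
  - by rewrite subrr normr0; ring.
  - by rewrite subrr normr0; ring.
  - by rewrite subr0 normr1; ring.
have -> : \sum_i (i \in ~: A)%:R * (a0 i - a1 i) =
    \sum_i a0 i - \sum_i a1 i - \sum_i a i * a0 i + \sum_i a i * a1 i.
  rewrite -!sumrB -big_split; apply: eq_bigr => i _.
  by rewrite finset.in_setC /a /=; case: (_ \in A) => /=; ring.
have -> : \sum_j (j \in B)%:R * (b0 j - b1 j) = \sum_j b j * b0 j - \sum_j b j * b1 j.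
  by rewrite -!sumrB; apply: eq_bigr => j _; rewrite mulrBr.
rewrite row_weighted col_weighted.
have -> : \sum_i \sum_j w i j = \sum_i a0 i + \sum_i a1 i.
  by rewrite -big_split; apply: eq_bigr => i _; rewrite row_sum.
ring.
Qed.

(** The mean of [g0 i] and [g1 i] is moved to [f] in row [i], the mean of
    [h0 j] and [h1 j] to [f] in column [j]; this is free because the one-way
    marginals of [w] are those of the other tables.  The shifts by 3/2, which
    cancel because the two totals of the first symbol agree, as do those of the
    second, send half-differences of values in [-1,2] to [0,3]. *)
Lemma table_pairingE f g0 g1 h0 h1 :
  table_pairing f g0 g1 h0 h1 =
  \sum_i \sum_j w i j * (f i j + (g0 i + g1 i) / 2 + (h0 j + h1 j) / 2) +
  \sum_i (3 / 2 + (g0 i - g1 i) / 2) * (a0 i - a1 i) -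
  \sum_j (3 / 2 - (h0 j - h1 j) / 2) * (b0 j - b1 j).
Proof.
have -> : \sum_i \sum_j w i j * (f i j + (g0 i + g1 i) / 2 + (h0 j + h1 j) / 2) =
    \sum_i \sum_j f i j * w i j + \sum_i \sum_j ((g0 i + g1 i) / 2) * w i j +
    \sum_i \sum_j ((h0 j + h1 j) / 2) * w i j.
  rewrite -!big_split /=; apply: eq_bigr => i _.
  by rewrite -!big_split /=; apply: eq_bigr => j _; ring.
have -> : \sum_i (3 / 2 + (g0 i - g1 i) / 2) * (a0 i - a1 i) =
    \sum_i (g0 i * a0 i + g1 i * a1 i) - \sum_i ((g0 i + g1 i) / 2) * a0 i -
    \sum_i ((g0 i + g1 i) / 2) * a1 i + 3 / 2 * \sum_i a0 i - 3 / 2 * \sum_i a1 i.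
  rewrite !mulr_sumr -!sumrB -big_split -sumrB.
  by apply: eq_bigr => i _ /=; field.
have -> : \sum_j (3 / 2 - (h0 j - h1 j) / 2) * (b0 j - b1 j) =
    3 / 2 * \sum_j b0 j - 3 / 2 * \sum_j b1 j - \sum_j (h0 j * b0 j + h1 j * b1 j) +
    \sum_j ((h0 j + h1 j) / 2) * b0 j + \sum_j ((h0 j + h1 j) / 2) * b1 j.
  rewrite !mulr_sumr -!sumrB -!big_split.
  by apply: eq_bigr => j _ /=; field.
rewrite row_weighted col_weighted mass0 mass1 /table_pairing; ring.
Qed.

(** The test family of the signs is the extremal case, where the rearranged
    pairing is exactly the cut energy at 3 times a pair of indicators. *)
Lemma table_pairing_test (A : {set I}) (B : {set J}) :
  let al i : R := if i \in A then 1 else -1 in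
  let be j : R := if j \in B then 1 else -1 in
  table_pairing (fun i j => 1 / 2 + 3 / 2 * (al i * be j))
    (fun i => 1 / 2 - 3 / 2 * al i) (fun i => 1 / 2 + 3 / 2 * al i)
    (fun j => 1 / 2 - 3 / 2 * be j) (fun j => 1 / 2 + 3 / 2 * be j) =
  - 6 * table_excess A B.
Proof.
move=> al be; rewrite table_pairingE.
have -> : - 6 * table_excess A B = 3 * (- 2 * table_excess A B) by ring.
rewrite -cut_energy_indicator /cut_energy mulrDr mulrDr mulrN !mulr_sumr.
congr (_ + _ - _); apply: eq_bigr => i _.
- rewrite mulr_sumr; apply: eq_bigr => j _.
  rewrite /al /be finset.in_setC; case: (_ \in A); case: (_ \in B) => /=.
  + by rewrite sub0r normrN normr1; field.
  + by rewrite subrr normr0; field.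
  + by rewrite subrr normr0; field.
  + by rewrite subr0 normr1; field.
- by rewrite /al finset.in_setC; case: (_ \in A) => /=; field.
- by rewrite /be; case: (_ \in B) => /=; field.
Qed.

(** After truncation at 2, the two covering constraints (one for each symbol of
    the third alphabet) say that the rearranged [f] dominates both x_i - y_j and
    y_j - x_i. *)
Lemma table_pairing_ge K f g0 g1 h0 h1 :
    (forall i j, 0 <= w i j) -> (forall i, 0 <= a0 i) -> (forall i, 0 <= a1 i) ->
    (forall j, 0 <= b0 j) -> (forall j, 0 <= b1 j) ->
    (forall i j, -1 <= f i j) -> (forall i, -1 <= g0 i) -> (forall i, -1 <= g1 i) ->
    (forall j, -1 <= h0 j) -> (forall j, -1 <= h1 j) ->
    (forall i j, 0 <= f i j + g0 i + h0 j) ->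
    (forall i j, 0 <= f i j + g1 i + h1 j) ->
    (forall A B, table_excess A B <= K) ->
  - 6 * K <= table_pairing f g0 g1 h0 h1.
Proof.
move=> w_ge0 a0_ge0 a1_ge0 b0_ge0 b1_ge0 f_ge g0_ge g1_ge h0_ge h1_ge cov0 cov1 exK.
pose tr (v : R) := Num.min v 2.
have trle v : tr v <= v by rewrite /tr ge_min lexx.
have trge v : -1 <= v -> -1 <= tr v by move=> v1; rewrite /tr le_min v1 /=; lra.
have tr2 v : tr v <= 2 by rewrite /tr ge_min lexx orbT.
(* Truncation preserves the constraint: if one of the three terms is
   truncated, it becomes 2 and the other two are at least -1. *)
have trcov a b c : -1 <= a -> -1 <= b -> -1 <= c -> 0 <= a + b + c ->
    0 <= tr a + tr b + tr c.
  move=> a1' b1' c1 abc; rewrite /tr /Num.min; do 3 case: ifP => _; lra.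
apply: (@le_trans _ _ (table_pairing (fun i j => tr (f i j)) (tr \o g0) (tr \o g1)
    (tr \o h0) (tr \o h1))); last first.
  rewrite /table_pairing; repeat apply: lerD; apply: ler_sum => i _.
  - by apply: ler_sum => j _; rewrite ler_wpM2r.
  - by apply: lerD; rewrite ler_wpM2r /=.
  - by apply: lerD; rewrite ler_wpM2r /=.
rewrite table_pairingE.
pose x i := 3 / 2 + (tr (g0 i) - tr (g1 i)) / 2.
pose y j := 3 / 2 - (tr (h0 j) - tr (h1 j)) / 2.
apply: (@le_trans _ _ (cut_energy x y)).
  rewrite (_ : - 6 * K = 3 * (- 2 * K)); last by ring.
  apply: cut_energy_ge => [A B||i|j]; last 2 first.
  - have := (trge _ (g0_ge i), trge _ (g1_ge i)); have := (tr2 (g0 i), tr2 (g1 i)).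
    by move=> [? ?] [? ?]; rewrite /x; apply/andP; split; lra.
  - have := (trge _ (h0_ge j), trge _ (h1_ge j)); have := (tr2 (h0 j), tr2 (h1 j)).
    by move=> [? ?] [? ?]; rewrite /y; apply/andP; split; lra.
  - have := cut_energy_indicator (~: A)%SET B; rewrite finset.setCK => ->.
    by have := exK (~: A)%SET B; lra.
  - by lra.
rewrite /cut_energy; do 2 apply: lerD => //; apply: ler_sum => i _.
apply: ler_sum => j _; apply: ler_wpM2l => //.
have := trcov _ _ _ (f_ge i j) (g0_ge i) (h0_ge j) (cov0 i j).
have := trcov _ _ _ (f_ge i j) (g1_ge i) (h1_ge j) (cov1 i j).
rewrite ler_norml /x /y /= => c1' c0'; apply/andP; split; lra.
Qed.
End Tables.

(** * Families with agreeing marginals *)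

Section Marginals.
Variables (R : realType) (d : nat) (X : 'I_d -> finType) (SS : {set {set 'I_d}}).
Implicit Types (p q : family_on R X SS).

(** The homogeneous part of consistency, which is stable under linear
    combinations. *)
Definition agree p := forall S1 S2 : {S : {set 'I_d} | S \in SS},
  (sval S1 :&: sval S2 != finset.set0)%SET ->
  marginal (finset.subsetIl (sval S1) (sval S2)) (p S1) =
  marginal (finset.subsetIr (sval S1) (sval S2)) (p S2).

Lemma restr_restr (S T U : {set 'I_d}) (sTS : T \subset S) (sUT : U \subset T)
    (sUS : U \subset S) (x : cart X S) : restr sUT (restr sTS x) = restr sUS x.
Proof.
apply/ffunP => -[j jU]; rewrite !ffunE /=.
by congr (x (exist _ _ _)); apply: bool_irrelevance.
Qed.

Lemma marginal_marginal (S T U : {set 'I_d}) (sTS : T \subset S)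
    (sUT : U \subset T) (sUS : U \subset S) (q : cart X S -> R) :
  marginal sUT (marginal sTS q) = marginal sUS q.
Proof.
apply/funext => y; rewrite /marginal.
rewrite [RHS](partition_big (restr sTS) (fun t => restr sUT t == y)) /=; last first.
  by move=> x; rewrite (restr_restr sTS sUT sUS).
apply: eq_bigr => t /eqP ty; apply: eq_bigl => x.
by case: eqP => [xt|]; rewrite ?andbF // -(restr_restr sTS sUT) xt ty eqxx.
Qed.

Lemma agree_marginals (mu : cart X [set: 'I_d]%SET -> R) :
  agree (marginals mu).
Proof.
move=> S1 S2 _; rewrite /marginals.
by rewrite !(marginal_marginal _ _ (finset.subsetT _)).
Qed.

Lemma agree_addf p q : agree p -> agree q -> agree (Defs.addf p q).
Proof.
move=> pA qA S1 S2 S12; apply/funext => y; rewrite /marginal /Defs.addf !big_split /=.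
have := congr1 (@^~ y) (pA S1 S2 S12); have := congr1 (@^~ y) (qA S1 S2 S12).
by rewrite /marginal => -> ->.
Qed.

Lemma agree_scalef a p : agree p -> agree (scalef a p).
Proof.
move=> pA S1 S2 S12; apply/funext => y; rewrite /marginal /scalef -!mulr_sumr.
by have := congr1 (@^~ y) (pA S1 S2 S12); rewrite /marginal => ->.
Qed.

Lemma pairing_addf p q f : pairing (Defs.addf p q) f = pairing p f + pairing q f.
Proof.
rewrite /pairing -big_split; apply: eq_bigr => S _; rewrite -big_split.
by apply: eq_bigr => x _; rewrite mulrDr.
Qed.

Lemma pairing_scalef a p f : pairing (scalef a p) f = a * pairing p f.
Proof.
rewrite /pairing mulr_sumr; apply: eq_bigr => S _; rewrite mulr_sumr.
by apply: eq_bigr => x _; rewrite mulrCA.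
Qed.

Lemma pairing_gplus_ge p f : Prob p -> Gplus f -> - #|SS|%:R <= pairing p f.
Proof.
move=> pP [f_ge _].
have -> : - #|SS|%:R = \sum_(S : {S : {set 'I_d} | S \in SS}) (-1) :> R.
  by rewrite sumr_const card_sig mulNrn.
apply: ler_sum => S _; have [p_ge0 p1] := pP S.
rewrite -p1 -sumrN; apply: ler_sum => x _; rewrite -mulN1r.
exact: (ler_wpM2r (p_ge0 x) (f_ge S x)).
Qed.

Lemma compat_pairing_ge0 p f : Compat p -> Gplus f -> 0 <= pairing p f.
Proof.
move=> [_ [mu [[mu_ge0 _] muP]]] [_ f_cover].
have -> : pairing p f = pairing (marginals mu) f.
  by apply: eq_bigr => S _; rewrite -muP.
by rewrite pairing_marginals; apply: sumr_ge0 => z _; rewrite mulr_ge0 ?f_cover.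
Qed.

Lemma compat_marginals mu : is_pmf mu -> Compat (marginals mu : family_on R X SS).
Proof.
move=> [mu_ge0 mu1]; split; last by exists mu.
by move=> S; split; [move=> x; exact: sumr_ge0|rewrite /marginals sum_marginal].
Qed.

Lemma compat_consistent p : Compat p -> Consistent p.
Proof.
move=> [pP [mu [_ muP]]]; split=> // S1 S2 S12.
by rewrite -!muP; apply: (agree_marginals mu).
Qed.

End Marginals.

(** * The three pairs of coordinates *)

(** Indexing the target by natural numbers makes the value at each of the
    three coordinates hold by computation, without transport. *)
Definition by_coord (U : nat -> Type) (u1 : U 0%N) (u2 : U 1%N) (u3 : U 2%N)
    (c : 'I_3) : U c :=
  match c with
  | Ordinal m h => match m return (m < 3)%N -> U m with
    | 0%N => fun _ => u1
    | 1%N => fun _ => u2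
    | 2%N => fun _ => u3
    | m'.+3 => fun h => False_rect _ (Bool.diff_false_true h)
    end h
  end.

Lemma ord3_ind (P : 'I_3 -> Prop) : P c1 -> P c2 -> P c3 -> forall c, P c.
Proof.
move=> P1 P2 P3 [[|[|[|m]]] h] //.
- by rewrite (bool_irrelevance h isT).
- by rewrite (bool_irrelevance h isT).
- by rewrite (bool_irrelevance h isT).
Qed.

Lemma pairs3_ind (P : {S : {set 'I_3} | S \in pairs3} -> Prop) :
  P S12 -> P S23 -> P S13 -> forall S, P S.
Proof.
move=> P12 P23 P13 [S SP].
have [e|[e|e]] : S = [set c1; c2]%SET \/ S = [set c2; c3]%SET \/ S = [set c1; c3]%SET.
- by move: SP; rewrite !inE => /orP[/orP[]|] /eqP; auto.
- by subst S; rewrite (bool_irrelevance SP S12_in).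
- by subst S; rewrite (bool_irrelevance SP S23_in).
- by subst S; rewrite (bool_irrelevance SP S13_in).
Qed.

Lemma pairs3_neq : [/\ S12 != S23, S12 != S13 & S23 != S13].
Proof.
by split; apply/eqP => /(congr1 sval) /setP E; [have := E c1|have := E c2|have := E c1];
  rewrite !inE.
Qed.

Lemma big_pairs3 (V : Type) (idx : V) (op : Monoid.com_law idx)
    (F : {S : {set 'I_3} | S \in pairs3} -> V) :
  \big[op/idx]_S F S = op (F S12) (op (F S13) (F S23)).
Proof.
have [n1 n2 n3] := pairs3_neq.
rewrite (bigD1 S12) //= (bigD1 S13) ?(eq_sym S13) //= (bigD1 S23) /=; last first.
  by rewrite (eq_sym S23 S12) n1 n3.
rewrite big_pred0 ?Monoid.mulm1 //.
by elim/pairs3_ind; rewrite ?eqxx ?andbF.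
Qed.

Lemma card_pairs3 : #|pairs3| = 3%N.
Proof. by rewrite -card_sig -sum1_card big_pairs3. Qed.

Lemma pairs3_meet (S1 S2 : {S : {set 'I_3} | S \in pairs3}) :
  (sval S1 :&: sval S2 != finset.set0)%SET.
Proof.
apply/finset.set0Pn; elim/pairs3_ind: S1; elim/pairs3_ind: S2.
all: first [by exists c1; rewrite !inE | by exists c2; rewrite !inE |
            by exists c3; rewrite !inE].
Qed.

Lemma big_ord2 (V : nmodType) (F : 'I_2 -> V) : \sum_k F k = F ord0 + F ord_max.
Proof.
by rewrite big_ord_recl big_ord1; congr (_ + F _); apply: val_inj.
Qed.

(** * Coordinates of the alphabets *)

Section Coordinates.
Variables (R : realType) (r s : nat).
Local Notation X := (alph r s).
Local Notation U := (fun m => 'I_(nth 0%N [:: r; s; 2%N] m)).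

Definition point (i : 'I_r) (j : 'I_s) (k : 'I_2) : cart X [set: 'I_3]%SET :=
  [ffun c : {c : 'I_3 | c \in [set: 'I_3]%SET} => @by_coord U i j k (sval c)].

Lemma point_surj z : exists i j k, z = point i j k.
Proof.
pose co c := z (exist _ c (finset.in_setT c)).
exists (co c1), (co c2), (co c3); apply/ffunP => -[c cT]; rewrite ffunE.
by elim/ord3_ind: c cT => cT; rewrite /co (bool_irrelevance cT (finset.in_setT _)).
Qed.

Lemma eq_restr_point (T : {set 'I_3}) i j k i' j' k' :
  (restr (finset.subsetT T) (point i j k) == restr (finset.subsetT T) (point i' j' k'))
  = [&& (c1 \in T) ==> (i == i'), (c2 \in T) ==> (j == j') & (c3 \in T) ==> (k == k')].
Proof.
apply/eqP/and3P => [E|[/implyP h1 /implyP h2 /implyP h3]].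
  split; apply/implyP => cT; apply/eqP;
    have := congr1 (fun x : cart X T => x (exist (fun c => is_true (c \in T)) _ cT)) E;
    by rewrite !ffunE.
apply/ffunP => -[c cT]; rewrite !ffunE /=.
by elim/ord3_ind: c cT => [/h1|/h2|/h3] /eqP ->.
Qed.

Lemma sum_cart12 (V : nmodType) (F : cart X (sval S12) -> V) k :
  \sum_x F x = \sum_i \sum_j F (proj S12 (point i j k)).
Proof.
rewrite pair_big (reindex (fun ij : 'I_r * 'I_s => proj S12 (point ij.1 ij.2 k))) //.
apply: onW_bij; exists (fun x => (@fst_coord X c1 c2 x, @snd_coord X c1 c2 x)).
  by case=> i j; rewrite /fst_coord /snd_coord !ffunE.
move=> x; apply/ffunP => -[c cT]; rewrite !ffunE /=.
elim/ord3_ind: c cT => cT.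
- by rewrite (bool_irrelevance cT (set21 _ _)).
- by rewrite (bool_irrelevance cT (set22 _ _)).
- by exfalso; move: cT; rewrite !inE.
Qed.

Lemma sum_cart13 (V : nmodType) (F : cart X (sval S13) -> V) j :
  \sum_x F x = \sum_i \sum_k F (proj S13 (point i j k)).
Proof.
rewrite pair_big (reindex (fun ik : 'I_r * 'I_2 => proj S13 (point ik.1 j ik.2))) //.
apply: onW_bij; exists (fun x => (@fst_coord X c1 c3 x, @snd_coord X c1 c3 x)).
  by case=> i k; rewrite /fst_coord /snd_coord !ffunE.
move=> x; apply/ffunP => -[c cT]; rewrite !ffunE /=.
elim/ord3_ind: c cT => cT.
- by rewrite (bool_irrelevance cT (set21 _ _)).
- by exfalso; move: cT; rewrite !inE.
- by rewrite (bool_irrelevance cT (set22 _ _)).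
Qed.

Lemma sum_cart23 (V : nmodType) (F : cart X (sval S23) -> V) i :
  \sum_x F x = \sum_j \sum_k F (proj S23 (point i j k)).
Proof.
rewrite pair_big (reindex (fun jk : 'I_s * 'I_2 => proj S23 (point i jk.1 jk.2))) //.
apply: onW_bij; exists (fun x => (@fst_coord X c2 c3 x, @snd_coord X c2 c3 x)).
  by case=> j k; rewrite /fst_coord /snd_coord !ffunE.
move=> x; apply/ffunP => -[c cT]; rewrite !ffunE /=.
elim/ord3_ind: c cT => cT.
- by exfalso; move: cT; rewrite !inE.
- by rewrite (bool_irrelevance cT (set21 _ _)).
- by rewrite (bool_irrelevance cT (set22 _ _)).
Qed.

Variables (i0 : 'I_r) (j0 : 'I_s).
Implicit Types (p f : family_on R X pairs3).

(** The coordinate outside each pair is filled in arbitrarily; [t12E], [t13E]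
    and [t23E] show that the choice does not matter. *)
Definition t12 p i j := p S12 (proj S12 (point i j ord0)).
Definition t13 p k i := p S13 (proj S13 (point i j0 k)).
Definition t23 p k j := p S23 (proj S23 (point i0 j k)).

Lemma t12E f i j k : f S12 (proj S12 (point i j k)) = t12 f i j.
Proof.
by congr (f S12 _); apply/eqP; rewrite eq_restr_point !inE !eqxx.
Qed.

Lemma t13E f i j k : f S13 (proj S13 (point i j k)) = t13 f k i.
Proof.
by congr (f S13 _); apply/eqP; rewrite eq_restr_point !inE !eqxx.
Qed.

Lemma t23E f i j k : f S23 (proj S23 (point i j k)) = t23 f k j.
Proof.
by congr (f S23 _); apply/eqP; rewrite eq_restr_point !inE !eqxx.
Qed.

(** Evaluating a further marginal at the restriction of a point turns its
    fibre into the equations on the coordinates in [T], so that agreement of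
    marginals becomes a statement on row and column sums. *)
Lemma fibre12 (T : {set 'I_3}) (sT : T \subset sval S12) p i j k :
  marginal sT (p S12) (restr (finset.subsetT T) (point i j k)) =
  \sum_i' \sum_j' if ((c1 \in T) ==> (i' == i)) && ((c2 \in T) ==> (j' == j))
                   then t12 p i' j' else 0.
Proof.
rewrite /marginal big_mkcond (sum_cart12 _ k); apply: eq_bigr => i' _.
apply: eq_bigr => j' _; rewrite t12E (restr_restr _ _ (finset.subsetT _)).
by rewrite eq_restr_point eqxx implybT ?andbT.
Qed.

Lemma fibre13 (T : {set 'I_3}) (sT : T \subset sval S13) p i j k :
  marginal sT (p S13) (restr (finset.subsetT T) (point i j k)) =
  \sum_i' \sum_k' if ((c1 \in T) ==> (i' == i)) && ((c3 \in T) ==> (k' == k))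
                   then t13 p k' i' else 0.
Proof.
rewrite /marginal big_mkcond (sum_cart13 _ j); apply: eq_bigr => i' _.
apply: eq_bigr => k' _; rewrite t13E (restr_restr _ _ (finset.subsetT _)).
by rewrite eq_restr_point eqxx implybT ?andbT.
Qed.

Lemma fibre23 (T : {set 'I_3}) (sT : T \subset sval S23) p i j k :
  marginal sT (p S23) (restr (finset.subsetT T) (point i j k)) =
  \sum_j' \sum_k' if ((c2 \in T) ==> (j' == j)) && ((c3 \in T) ==> (k' == k))
                   then t23 p k' j' else 0.
Proof.
rewrite /marginal big_mkcond (sum_cart23 _ i); apply: eq_bigr => j' _.
apply: eq_bigr => k' _; rewrite t23E (restr_restr _ _ (finset.subsetT _)).
by rewrite eq_restr_point eqxx implybT ?andbT.
Qed.

Lemma big_only (I : finType) (i : I) (G : I -> R) :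
  (forall i', i' != i -> G i' = 0) -> \sum_i' G i' = G i.
Proof. by move=> G0; rewrite (bigD1 i) //= big1 ?addr0. Qed.

Lemma agree_row p i : agree p -> \sum_j t12 p i j = t13 p ord0 i + t13 p ord_max i.
Proof.
move=> /(_ S12 S13 (pairs3_meet _ _))/(congr1 (@^~ _)) /=.
move/(_ (restr (finset.subsetT _) (point i j0 ord0))).
rewrite fibre12 fibre13 (big_only (i := i)) => [|i' /negPf ii]; last first.
  by apply: big1 => j _; rewrite ii !inE.
rewrite [X in _ = X -> _](big_only (i := i)) => [|i' /negPf ii]; last first.
  by apply: big1 => k _; rewrite ii !inE.
rewrite big_ord2 !inE !eqxx /= => <-.
by apply: eq_bigr => j _; rewrite ?eqxx.
Qed.

Lemma agree_col p j : agree p -> \sum_i t12 p i j = t23 p ord0 j + t23 p ord_max j.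
Proof.
move=> /(_ S12 S23 (pairs3_meet _ _))/(congr1 (@^~ _)) /=.
move/(_ (restr (finset.subsetT _) (point i0 j ord0))).
rewrite fibre12 fibre23 exchange_big (big_only (i := j)) => [|j' /negPf jj]; last first.
  by apply: big1 => i _; rewrite jj !inE.
rewrite [X in _ = X -> _](big_only (i := j)) => [|j' /negPf jj]; last first.
  by apply: big1 => k _; rewrite jj !inE.
rewrite big_ord2 !inE !eqxx /= => <-.
by apply: eq_bigr => i _; rewrite ?eqxx.
Qed.

Lemma agree_top p : agree p -> \sum_i t13 p ord0 i = \sum_j t23 p ord0 j.
Proof.
move=> /(_ S13 S23 (pairs3_meet _ _))/(congr1 (@^~ _)) /=.
move/(_ (restr (finset.subsetT _) (point i0 j0 ord0))); rewrite fibre13 fibre23.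
rewrite !inE /= => E.
transitivity (\sum_i \sum_k if k == ord0 then t13 p k i else 0).
  by apply: eq_bigr => i _; rewrite big_ord2 /= addr0.
by rewrite E; apply: eq_bigr => j _; rewrite big_ord2 /= addr0.
Qed.

Lemma excessE p A B :
  excess p A B = table_excess (t12 p) (t13 p ord0) (t23 p ord0) A B.
Proof.
have E1 (A' : {set 'I_r}) : pA_1 p A' = \sum_(i in A') t13 p ord0 i.
  rewrite /pA_1 /rect_mass big_mkcond (sum_cart13 _ j0) [RHS]big_mkcond.
  apply: eq_bigr => i _; rewrite big_ord2 /fst_coord /snd_coord !ffunE /= !inE andbT.
  by rewrite andbF addr0.
rewrite /excess /p__1 !E1 /table_excess; congr (- _ + _ + _ - _).
- rewrite /pAB_ /rect_mass big_mkcond (sum_cart12 _ ord0) [RHS]big_mkcond.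
  apply: eq_bigr => i _; rewrite [in RHS]big_mkcond /fst_coord /snd_coord.
  case: ifP => iA; [apply: eq_bigr => j _|apply: big1 => j _]; by rewrite !ffunE /= iA.
- rewrite /p_B1 /rect_mass big_mkcond (sum_cart23 _ i0) [RHS]big_mkcond.
  apply: eq_bigr => j _; rewrite big_ord2 /fst_coord /snd_coord !ffunE /= !inE andbT.
  by rewrite andbF addr0.
- by apply: eq_bigl => i; rewrite inE.
Qed.

Lemma pairingE p f :
  pairing p f = table_pairing (t12 p) (t13 p ord0) (t13 p ord_max)
    (t23 p ord0) (t23 p ord_max) (t12 f) (t13 f ord0) (t13 f ord_max)
    (t23 f ord0) (t23 f ord_max).
Proof.
rewrite /pairing big_pairs3 /= addrA /table_pairing; congr (_ + _ + _).
- by rewrite (sum_cart12 _ ord0).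
- by rewrite (sum_cart13 _ j0); apply: eq_bigr => i _; rewrite big_ord2.
- by rewrite (sum_cart23 _ i0); apply: eq_bigr => i _; rewrite big_ord2.
Qed.

Lemma pairing_ge p f K : (forall S x, 0 <= p S x) -> agree p -> Gplus f ->
  (forall A B, excess p A B <= K) -> - 6 * K <= pairing p f.
Proof.
move=> p_ge0 pA [f_ge f_cover] exK; rewrite pairingE.
have cover i j k : 0 <= t12 f i j + t13 f k i + t23 f k j.
  have := f_cover (point i j k); rewrite big_pairs3 /=.
  by rewrite -/(proj _ _) t12E -/(proj _ _) t13E -/(proj _ _) t23E addrA.
apply: table_pairing_ge => //; try by move=> *; (apply: p_ge0 || apply: f_ge).
- by move=> i; apply: agree_row.
- by move=> j; apply: agree_col.
- exact: agree_top.
- by move=> A B; rewrite -excessE.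
Qed.

(** The third sign is reversed, so that the three products of two signs are
    ab, -ac and -bc. *)
Definition sign_coord (A : {set 'I_r}) (B : {set 'I_s}) : forall c, X c -> R :=
  @by_coord (fun m => U m -> R) (fun i : 'I_r => if i \in A then 1 else -1)
    (fun j : 'I_s => if j \in B then 1 else -1)
    (fun k : 'I_2 => if k == ord0 then -1 else 1).

Lemma norm_sign_coord A B c (v : X c) : `|sign_coord A B v| = 1.
Proof.
by elim/ord3_ind: c v => v; rewrite /sign_coord /=; case: ifP; rewrite ?normrN1 ?normr1.
Qed.

(** Written as a product over the coordinates of S, the test functions need no
    case distinction on S. *)
Definition cut_test (A : {set 'I_r}) (B : {set 'I_s}) : family_on R X pairs3 :=
  fun S x => 1 / 2 + 3 / 2 * \prod_(c : {c | c \in sval S}) sign_coord A B (x c).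

Lemma cut_test_pair A B (S : {S : {set 'I_3} | S \in pairs3}) c c' i j k :
  sval S = [set c; c']%SET -> c != c' ->
  cut_test A B (proj S (point i j k)) = 1 / 2 + 3 / 2 *
    (sign_coord A B (@by_coord U i j k c : X c) *
     sign_coord A B (@by_coord U i j k c' : X c')).
Proof.
move=> Sc cc'; rewrite /cut_test; congr (_ + _ * _).
pose G c := sign_coord A B (@by_coord U i j k c : X c).
transitivity (\prod_(c in sval S) G c).
  by rewrite [RHS]big_sub; apply: eq_bigr => -[b bS] _; rewrite !ffunE.
by rewrite Sc big_setU1 ?big_set1 // inE.
Qed.

(** The three sign products multiply to 1, so their sum is -1 or 3. *)
Lemma cut_test_gplus A B : Gplus (cut_test A B).
Proof.
split=> [S x|z].
  suff : -1 <= \prod_(c : {c | c \in sval S}) sign_coord A B (x c).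
    by rewrite /cut_test; lra.
  set pr := \prod_c _; have pr1 : `|pr| <= 1.
    by rewrite normr_prod big1 // => c _; apply: norm_sign_coord.
  by move: pr1; rewrite ler_norml => /andP[].
have [i [j [k ->]]] := point_surj z.
rewrite big_pairs3 /= -!/(proj _ _).
rewrite (@cut_test_pair _ _ S12 c1 c2) // (@cut_test_pair _ _ S13 c1 c3) //.
rewrite (@cut_test_pair _ _ S23 c2 c3) // /sign_coord /=.
case: (i \in A); case: (j \in B); case: (k == ord0); lra.
Qed.

Lemma pairing_cut_test p A B : agree p -> pairing p (cut_test A B) = - 6 * excess p A B.
Proof.
move=> pA; rewrite excessE pairingE.
rewrite -(@table_pairing_test _ _ _ _ _ (t13 p ord_max) _ (t23 p ord_max)).
- rewrite /table_pairing /t12 /t13 /t23; congr (_ + _ + _).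
  + apply: eq_bigr => i _; apply: eq_bigr => j _.
    by rewrite (@cut_test_pair _ _ S12 c1 c2).
  + apply: eq_bigr => i _; rewrite !(@cut_test_pair _ _ S13 c1 c3) //= /sign_coord /= ?eqxx.
    by case: (i \in A); field.
  + apply: eq_bigr => j _; rewrite !(@cut_test_pair _ _ S23 c2 c3) //= /sign_coord /= ?eqxx.
    by case: (j \in B); field.
- by move=> i; apply: agree_row.
- by move=> j; apply: agree_col.
- exact: agree_top.
Qed.
End Coordinates.

(** * The incompatibility index and the Minkowski sum *)

Lemma le_max_subsets (R : realType) r s (F : {set 'I_r} -> {set 'I_s} -> R) A B :
  F A B <= max_subsets F.
Proof.
rewrite /max_subsets.
exact: (Order.TotalTheory.le_bigmax_seq _ (A, B) xpredT (fun AB => F AB.1 AB.2)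
  (mem_index_enum _) isT).
Qed.

Lemma max_subsets_attained (R : realType) r s (F : {set 'I_r} -> {set 'I_s} -> R) :
  exists A B, max_subsets F = F A B.
Proof.
rewrite /max_subsets; apply: (big_ind (fun v => exists A B, v = F A B)).
- by exists finset.set0, finset.set0.
- by move=> u v [A [B ->]] [A' [B' ->]]; rewrite /Num.max; case: ifP => _;
    [exists A', B'|exists A, B].
- by move=> [A B] _; exists A, B.
Qed.

Section Cone.
Variables (R : realType) (r s : nat) (i0 : 'I_r) (j0 : 'I_s).
Local Notation X := (alph r s).
Implicit Types (p q : family_on R X pairs3).

Lemma agree_mass p S1 S2 : agree p -> \sum_x p S1 x = \sum_x p S2 x.
Proof.
move=> /(_ S1 S2 (pairs3_meet _ _)) E.
rewrite -(sum_marginal (finset.subsetIl (sval S1) (sval S2)) (p S1)) E.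
exact: sum_marginal.
Qed.

(** As any two of the three pairs meet, agreeing marginals force equal masses,
    and dividing by the common mass gives a consistent family.  If the mass is 0,
    any consistent family will do, such as the marginals of a point mass. *)
Lemma scalef_mass_consistent p : (forall S x, 0 <= p S x) -> agree p ->
  exists2 q, Consistent q & p = scalef (\sum_x p S12 x) q.
Proof.
move=> p_ge0 pA; set m := \sum_x p S12 x.
have pm S : \sum_x p S x = m by apply: agree_mass.
have [m0|m_neq0] := eqVneq m 0.
  pose z0 := point i0 j0 ord0.
  exists (marginals (fun z => (z == z0)%:R)).
    apply/compat_consistent/compat_marginals; split=> [z|]; first exact: ler0n.
    by under eq_bigr do rewrite -[(_ == _)%:R]mulr1; rewrite sum_delta.
  apply/functional_extensionality_dep => S; apply/funext => x.
  rewrite /scalef m0 mul0r; apply/eqP.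
  have := pm S; rewrite m0 => /eqP; rewrite psumr_eq0 //.
  by move/allP/(_ x (mem_index_enum _)).
have m_gt0 : 0 < m by rewrite lt_neqAle eq_sym m_neq0 sumr_ge0.
exists (scalef m^-1 p); last first.
  apply/functional_extensionality_dep => S; apply/funext => x.
  by rewrite /scalef mulrA divff // mul1r.
split; last exact: agree_scalef.
move=> S; split=> [x|]; first by rewrite /scalef mulr_ge0 // invr_ge0 ltW.
by rewrite /scalef -mulr_sumr pm mulVf.
Qed.

Lemma consistent_cone p :
  @ConsistentCone R 3 X pairs3 p <-> (forall S x, 0 <= p S x) /\ agree p.
Proof.
split=> [[a a_ge0] [q [qP qA] <-]|[p_ge0 pA]].
  by split; [move=> S x; rewrite mulr_ge0 //; case: (qP S)|exact: agree_scalef].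
have [q qC ->] := scalef_mass_consistent p_ge0 pA.
by exists (\sum_x p S12 x); [apply: sumr_ge0|exists q].
Qed.

Lemma excess_pairing p A B : agree p -> excess p A B = - (pairing p (cut_test R A B) / 6).
Proof. by move=> pA; rewrite (pairing_cut_test i0 j0) //; field. Qed.

(** The supremum is attained at the test function of a maximising pair, or at 0
    if no excess is positive. *)
Lemma incompat_consistent p : Consistent p ->
  incompat p = 2 * max_subsets (fun A B => pos_part (excess p A B)).
Proof.
move=> [pP pA]; set K := max_subsets _.
have K_ge A B : excess p A B <= K.
  by apply: le_trans (le_max_subsets _ A B); rewrite /pos_part le_max lexx.
have objE f : incompat_obj p f = - (pairing p f / 3).
  by rewrite /incompat_obj card_pairs3 mulrC.
have ubK : ubound [set incompat_obj p f | f in @Gplus R 3 X pairs3] (2 * K).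
  move=> _ [f fG <-]; rewrite objE.
  have := pairing_ge i0 j0 (fun S => (pP S).1) pA fG K_ge; lra.
have hasK : [set incompat_obj p f | f in @Gplus R 3 X pairs3] (2 * K).
  have [A [B KAB]] := max_subsets_attained (fun A B => pos_part (excess p A B)).
  have [ex_le0|ex_gt0] := leP (excess p A B) 0.
    exists (fun _ _ => 0); first by split=> [S x|x]; rewrite ?oppr_le0 ?ler01 // big1.
    rewrite objE /pairing big1 => [|S _]; last by rewrite big1 // => x _; rewrite mul0r.
    by rewrite /K KAB /pos_part max_r // mulr0 mul0r oppr0.
  exists (cut_test R A B); first exact: cut_test_gplus.
  rewrite objE (pairing_cut_test i0 j0) // /K KAB /pos_part max_l ?ltW //; by field.
apply/eqP; rewrite eq_le; apply/andP; split.
  by apply: ge_sup => //; exists (2 * K).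
by apply: ub_le_sup => //; exists (2 * K).
Qed.

(** An excess of at most 1/2 bounds the pairing with every admissible family
    below by -3, so all but mass 1 of [p] can be packed; the unpacked
    remainder has agreeing marginals because both [p] and the packed part do. *)
Lemma split_compat p : (forall S x, 0 <= p S x) -> agree p ->
    (forall A B, excess p A B <= 1 / 2) ->
  msum (@CompatCone R 3 X pairs3) (@ConsistentSub R 3 X pairs3) p.
Proof.
move=> p_ge0 pA exp.
have pairs3_gt0 : (0 < #|pairs3|)%N by rewrite card_pairs3.
have [|mu [mu_ge0 mu_le mu_mass]] :=
    @packing_of_pairing_ge R 3 X pairs3 p (\sum_x p S12 x) 1 pairs3_gt0 p_ge0
      (fun S => agree_mass S S12 pA).
- move=> f fG; by have := pairing_ge i0 j0 p_ge0 pA fG exp; rewrite card_pairs3; lra.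
pose q : family_on R X pairs3 := Defs.addf p (scalef (-1) (marginals mu)).
have q_ge0 S x : 0 <= q S x.
  by rewrite /q /Defs.addf /scalef mulN1r subr_ge0.
have qA : agree q by apply: agree_addf => //; apply/agree_scalef/agree_marginals.
have q_mass : \sum_x q S12 x = \sum_x p S12 x - \sum_z mu z.
  rewrite /q /Defs.addf /scalef big_split /= -mulr_sumr mulN1r.
  by rewrite /marginals sum_marginal.
exists (marginals mu); [|exists q].
- have [mu0|mu_neq0] := eqVneq (\sum_z mu z) 0.
    have mz z : mu z = 0.
      by move/eqP: mu0; rewrite psumr_eq0 // => /allP/(_ z (mem_index_enum _))/eqP.
    exists 0; first exact: lexx.
    exists (marginals (fun z => (z == point i0 j0 ord0)%:R)).
      apply: compat_marginals; split=> [z|]; first exact: ler0n.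
      by under eq_bigr do rewrite -[(_ == _)%:R]mulr1; rewrite sum_delta.
    apply/functional_extensionality_dep => S; apply/funext => x.
    by rewrite /scalef mul0r /marginals /marginal big1.
  have mu_gt0 : 0 < \sum_z mu z by rewrite lt_neqAle eq_sym mu_neq0 sumr_ge0.
  exists (\sum_z mu z); first exact: ltW.
  exists (marginals (fun z => mu z / \sum_z mu z)).
    apply: compat_marginals; split=> [z|]; first by rewrite divr_ge0 // ltW.
    by rewrite -mulr_suml divff.
  apply/functional_extensionality_dep => S; apply/funext => x.
  by rewrite /scalef /marginals /marginal -mulr_suml mulrCA divff ?mulr1.
- have [q' q'C qE] := scalef_mass_consistent q_ge0 qA.
  exists (\sum_x q S12 x); last by exists q'.
  by apply/andP; split; [apply: sumr_ge0|rewrite q_mass; lra].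
- apply/functional_extensionality_dep => S; apply/funext => x.
  by rewrite /q /Defs.addf /scalef mulN1r addrC subrK.
Qed.

(** By [excess_pairing] the excess is linear; the compatible part contributes at
    most 0, and a consistent part of mass at most 1 at most 1/2, because a test
    function that is at least -1 on each of three pairs integrates to at
    least -3. *)
Lemma excess_msum p A B :
  msum (@CompatCone R 3 X pairs3) (@ConsistentSub R 3 X pairs3) p ->
  [/\ forall S x, 0 <= p S x, agree p & excess p A B <= 1 / 2].
Proof.
move=> [_ [a a_ge0 [q qC <-]] [_ [b /andP[b_ge0 b_le1] [t tC <-]] <-]].
have [qP qA] := compat_consistent qC; have [tP tA] := tC.
have pA : agree (Defs.addf (scalef a q) (scalef b t)).
  by apply: agree_addf; apply: agree_scalef.
split=> // [S x|].
  rewrite /Defs.addf /scalef addr_ge0 // mulr_ge0 //; first by case: (qP S).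
  by case: (tP S).
rewrite excess_pairing // pairing_addf !pairing_scalef.
have gG := cut_test_gplus R A B.
have := mulr_ge0 a_ge0 (compat_pairing_ge0 qC gG).
have := ler_wpM2l b_ge0 (pairing_gplus_ge tP gG); rewrite card_pairs3; lra.
Qed.
End Cone.

Theorem theorem7 (R : realType) (r s : nat) (hr : (0 < r)%N) (hs : (0 < s)%N) :
  (forall p : family_on R (alph r s) pairs3, Consistent p ->
     incompat p = 2 * max_subsets (fun A B => pos_part (excess p A B))) /\
  msum (@CompatCone R 3 (alph r s) pairs3) (@ConsistentSub R 3 (alph r s) pairs3) =
  [set p | @ConsistentCone R 3 (alph r s) pairs3 p /\
           max_subsets (excess p) <= 1 / 2].
Proof.
pose i0 := Ordinal hr; pose j0 := Ordinal hs.
split; first exact: (incompat_consistent i0 j0).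
apply/seteqP; split=> p /=.
  move=> pM; split.
    by apply/(consistent_cone i0 j0); case: (excess_msum i0 j0 finset.set0 finset.set0 pM).
  have [A [B ->]] := max_subsets_attained (excess p).
  by case: (excess_msum i0 j0 A B pM).
case=> /(consistent_cone i0 j0)[p_ge0 pA] exp.
apply: (split_compat i0 j0) => // A B.
exact: le_trans (le_max_subsets _ A B) exp.
Qed.
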